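(* (Mayer–Vietoris sequence.) Let $X$ be a metric space and let $\{A,B\}$ be a discrete cover of $X$ at scale $r>0$. Then there is a long exact sequence $$\cdots\xrightarrow{\partial_*}DH_{n,r}(A\cap B)\xrightarrow{\mathrm{diag}}DH_{n,r}(A)\oplus DH_{n,r}(B)\xrightarrow{\mathrm{diff}}DH_{n,r}(A\cup B)\xrightarrow{\partial_*}DH_{n-1,r}(A\cap B)\xrightarrow{\mathrm{diag}}\cdots$$ where $\mathrm{diag}=(i^1_*,i^2_* )$ and $\mathrm{diff}=j^1_*-j^2_*$, with $i^1:A\cap B\to A$, $i^2:A\cap B\to B$, $j^1:A\to A\cup B$, $j^2:B\to A\cup B$ the canonical inclusions.
   Context: **Discrete homology at scale $r$** of a metric space $(X,d)$, for $r>0$. Let $Q_n=\{0,1\}^n$ with the Hamming distance. A singular $(n,r)$-cube in $X$ is an $r$-Lipschitz map $\sigma:Q_n\to X$, i.e. $d(\sigma(a),\sigma(b))\le r\,d_{Q_n}(a,b)$ for all $a,b$. Let $L_{n,r}(X)$ be the free abelian group on the singular $(n,r)$-cubes. For $n\ge1$ and $1\le i\le n$ put $(A_i^n\sigma)(a_1,\dots,a_{n-1})=\sigma(a_1,\dots,a_{i-1},0,a_i,\dots,a_{n-1})$ and $(B_i^n\sigma)(a_1,\dots,a_{n-1})=\sigma(a_1,\dots,a_{i-1},1,a_i,\dots,a_{n-1})$. The cube $\sigma$ is degenerate if $A_i^n\sigma=B_i^n\sigma$ for some $i$. Let $D_{n,r}(X)$ be the subgroup generated by the degenerate cubes and $C_{n,r}(X)=L_{n,r}(X)/D_{n,r}(X)$.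 The boundary $\partial\sigma=\sum_{i=1}^n(-1)^i(A_i^n\sigma-B_i^n\sigma)$ induces $\partial_n:C_{n,r}(X)\to C_{n-1,r}(X)$ (groups in negative degree are zero), and $DH_{n,r}(X)=\ker\partial_n/\operatorname{Im}\partial_{n+1}$. An inclusion of subspaces induces maps on $DH_{n,r}$ by composition with cubes. The maps $\partial_*$ in the sequence are connecting homomorphisms whose existence is part of the assertion. **Discrete cover.** A discrete cover of $X$ at scale $r$ is a family $\{U_i\}$ of subsets of $X$ with $X=\bigcup U_i$ such that, for every $n$, every non-degenerate singular $(n,r)$-cube in $X$ has image contained in some $U_i$. *)

(* Defs.v *)
From HB Require Import structures.
From mathcomp Require Import all_boot all_order all_algebra.
From mathcomp Require Import generic_quotient ring_quotient.
From mathcomp.multinomials Require Import freeg.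
From mathcomp Require Import all_classical reals topology_structure.
From mathcomp Require Import uniform_structure pseudometric_structure initial_topology.
From mathcomp Require Import subtype_topology metric_structure.

Set Implicit Arguments.
Unset Strict Implicit.
Unset Printing Implicit Defensive.

Import Order.TTheory GRing.Theory Num.Theory.
Local Open Scope classical_set_scope.
Local Open Scope quotient_scope.
Local Open Scope ring_scope.

Notation "{ 'quot' I }" := (Quotient.quot I) : type_scope.

Section AbelianGroups.
Implicit Types U V W : zmodType.

Definition subgroup V (H : set V) :=
  H 0 /\ forall x y, H x -> H y -> H (x - y).

Definition gen_subgroup V (G : set V) : {pred V} :=
  fun x => `[< smallest (@subgroup V) G x >].

Lemma gen_subgroup_zmod_closed V (G : set V) : zmod_closed (gen_subgroup G).
Proof.
split=> [|x y]; first by apply/asboolP => H [[]].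
move=> /asboolP xG /asboolP yG; apply/asboolP => H HG.
by case: (HG) => -[_ +] _; apply; [exact: xG | exact: yG].
Qed.
HB.instance Definition _ V (G : set V) :=
  GRing.isZmodClosed.Build V (gen_subgroup G) (gen_subgroup_zmod_closed G).

Definition ker_pred U V (f : {additive U -> V}) : {pred U} := fun x => f x == 0.

Lemma ker_zmod_closed U V (f : {additive U -> V}) : zmod_closed (ker_pred f).
Proof.
split=> [|x y]; first by rewrite unfold_in /ker_pred raddf0.
rewrite !unfold_in /ker_pred => /eqP fx /eqP fy.
by rewrite raddfB fx fy subrr.
Qed.
HB.instance Definition _ U V (f : {additive U -> V}) :=
  GRing.isZmodClosed.Build U (ker_pred f) (ker_zmod_closed f).

Definition kernel U V (f : {additive U -> V}) := {x : U | x \in ker_pred f}.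
HB.instance Definition _ U V (f : {additive U -> V}) :=
  SubChoice.on (kernel f).
HB.instance Definition _ U V (f : {additive U -> V}) :=
  [SubChoice_isSubZmodule of kernel f by <:].

Lemma kernelP U V (f : {additive U -> V}) (x : kernel f) : f (val x) = 0.
Proof. exact/eqP/(valP x). Qed.

(* The elements of ker g lying in the image of f; g \o f = 0 is not required. *)
Definition im_pred U V W (f : {additive U -> V}) (g : {additive V -> W}) :
  {pred kernel g} := fun y => `[< exists x, f x = val y >].
Arguments im_pred {U V W} f g _.

Lemma im_zmod_closed U V W (f : {additive U -> V}) (g : {additive V -> W}) :
  zmod_closed (im_pred f g).
Proof.
split=> [|x y]; first by apply/asboolP; exists 0; rewrite !raddf0.
move=> /asboolP[u ux] /asboolP[v vy]; apply/asboolP; exists (u - v).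
by rewrite !raddfB /= ux vy.
Qed.
HB.instance Definition _ U V W (f : {additive U -> V}) (g : {additive V -> W}) :=
  GRing.isZmodClosed.Build (kernel g) (im_pred f g) (im_zmod_closed f g).

Definition homology U V W (f : {additive U -> V}) (g : {additive V -> W}) :
  zmodType := {quot (im_pred f g)}.

Definition exact_at U V W (f : U -> V) (g : V -> W) :=
  forall y, g y = 0 <-> exists x, f x = y.

Section QuotMap.
Variables (U V : zmodType) (I : zmodClosed U) (J : zmodClosed V).
Variables (f : {additive U -> V}).

(* fIJ is what makes this independent of the representative (quot_mapE). *)
Definition quot_map (fIJ : forall x, x \in I -> f x \in J) (x : {quot I}) : {quot J} := \pi_({quot J}) (f (repr x)).

Hypothesis fIJ : forall x, x \in I -> f x \in J.

Lemma quot_mapE x : quot_map fIJ (\pi_({quot I}) x) = \pi_({quot J}) (f x).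
Proof.
apply/eqP; rewrite /quot_map -Quotient.idealrBE -raddfB; apply: fIJ.
by rewrite Quotient.idealrBE reprK.
Qed.

Lemma quot_map_zmod_morphism : zmod_morphism (quot_map fIJ).
Proof.
move=> x y; rewrite -[x]reprK -[y]reprK -raddfB !quot_mapE.
by rewrite -raddfB; congr (\pi_({quot J}) _); rewrite raddfB.
Qed.
HB.instance Definition _ :=
  GRing.isZmodMorphism.Build {quot I} {quot J} (quot_map fIJ)
  quot_map_zmod_morphism.
End QuotMap.
Arguments quot_map {U V I J f} fIJ x.

Section KernelMap.
Variables (U V U' V' : zmodType).
Variables (g : {additive U -> V}) (g' : {additive U' -> V'}).
Variables (h : {additive U -> U'}) (k : {additive V -> V'}).
Hypothesis hk : forall x, g' (h x) = k (g x).

Lemma kernel_map_subproof (x : kernel g) : h (val x) \in ker_pred g'.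
Proof. by apply/eqP; rewrite hk kernelP raddf0. Qed.

Definition kernel_map (x : kernel g) : kernel g' :=
  Sub (h (val x)) (kernel_map_subproof x).

Lemma kernel_map_zmod_morphism : zmod_morphism kernel_map.
Proof. by move=> x y; apply: val_inj; rewrite /= !raddfB. Qed.
HB.instance Definition _ := GRing.isZmodMorphism.Build
  (kernel g) (kernel g') kernel_map kernel_map_zmod_morphism.
End KernelMap.

Section HomologyMap.
Variables (U V W U' V' W' : zmodType).
Variables (f : {additive U -> V}) (g : {additive V -> W}).
Variables (f' : {additive U' -> V'}) (g' : {additive V' -> W'}).
Variables (a : {additive U -> U'}) (b : {additive V -> V'}).
Variables (c : {additive W -> W'}).
Hypotheses (fab : forall x, f' (a x) = b (f x)).
Hypotheses (gbc : forall x, g' (b x) = c (g x)).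

Lemma homology_map_subproof (x : kernel g) :
  x \in im_pred f g -> kernel_map gbc x \in im_pred f' g'.
Proof. by move=> /asboolP[u ux]; apply/asboolP; exists (a u); rewrite fab ux. Qed.

Definition homology_map : {additive homology f g -> homology f' g'} :=
  quot_map homology_map_subproof.
End HomologyMap.

Section FreeLift.
Variables (K : choiceType) (V : zmodType).

(* The additive extension of f to the free abelian group on K. *)
Definition freelift (f : K -> V) : {freeg K} -> V := fglift (f : K -> zmodule V).

Lemma freelift_zmod_morphism f : zmod_morphism (freelift f).
Proof. exact: (@lift_is_additive int K (zmodule V) f). Qed.
HB.instance Definition _ f := GRing.isZmodMorphism.Build
  {freeg K} V (freelift f) (freelift_zmod_morphism f).

Lemma freeliftU f k : freelift f << k >> = f k.
Proof. by rewrite /freelift liftU scale1r. Qed.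

Lemma freeg_ind_gen (P : {freeg K} -> Prop) :
  P 0 -> (forall k, P << k >>) -> (forall x y, P x -> P y -> P (x - y)) ->
  forall x, P x.
Proof.
move=> P0 PU PB.
have PN x : P x -> P (- x) by move=> /(PB _ _ P0); rewrite sub0r.
have PD x y : P x -> P y -> P (x + y).
  by move=> Px Py; rewrite -[y]opprK; apply: PB (PN _ Py).
have PM x n : P x -> P (x *+ n).
  by move=> Px; elim: n => [|n IH]; rewrite ?mulr0n // mulrS; apply: PD.
move=> x; rewrite -(freeg_sumE x); elim/big_ind: _ => // k _.
have -> : << coeff k x *g k >> = (<< k >> : {freeg K}) *~ coeff k x.
  case: (coeff k x) => n; first by rewrite -pmulrn freegU_muln natz.
  by rewrite NegzE mulrNz -pmulrn freegU_muln freegUN natz.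
by case: (coeff k x) => n; [exact: PM | rewrite NegzE mulrNz; exact/PN/PM].
Qed.

Lemma freelift_unique (f g : {additive {freeg K} -> V}) :
  (forall k, f << k >> = g << k >>) -> f =1 g.
Proof.
move=> fg; elim/freeg_ind_gen => [|//|x y fx fy]; first by rewrite !raddf0.
by rewrite !raddfB fx fy.
Qed.
End FreeLift.

End AbelianGroups.

Section MetricSubspace.
Variables (R : realType) (X : metricType R) (A : set X).

Let sub_dist (x y : A) : R := mdist (val x) (val y).

Let sub_dist_ge0 x y : 0 <= sub_dist x y. Proof. exact: mdist_ge0. Qed.

Let sub_dist_positivity x y : sub_dist x y = 0 -> x = y.
Proof. by move=> /mdist_positivity; apply: val_inj. Qed.

Let sub_ballE (x : A) (e : R) : ball x e = [set y | sub_dist x y < e].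
Proof.
apply/seteqP; split=> y; rewrite /ball /= /initial_ball /= /sub_dist;
by rewrite ballEmdist.
Qed.

(* The library already gives set_type A the pseudometric induced from X. *)
HB.instance Definition _ := PseudoMetric_isMetric.Build R (set_type A)
  sub_dist_ge0 sub_dist_positivity sub_ballE.

Lemma mdist_subE (x y : set_type A) : mdist x y = mdist (val x) (val y).
Proof. by []. Qed.
End MetricSubspace.

Section Cubes.

Definition hypercube (n : nat) := {ffun 'I_n -> bool}.

Definition hamming n (a b : hypercube n) : nat := #|[pred i | a i != b i]|.

Variables (R : realType) (r : R).
Implicit Types (X Y : metricType R).

Definition lipschitz_cube n X (s : hypercube n -> X) : Prop :=
  forall a b, mdist (s a) (s b) <= r * (hamming a b)%:R.

Record cube n X := Cube {
  cube_fun :> {ffun hypercube n -> X};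
  _ : `[< lipschitz_cube cube_fun >] }.
HB.instance Definition _ n X := [isSub for @cube_fun n X].
HB.instance Definition _ n X := [Choice of cube n X by <:].

Lemma cube_lipschitz n X (s : cube n X) : lipschitz_cube s.
Proof. by case: s => s /= /asboolP. Qed.

(* Inserts the bit b at position i. For n = 0 there is no i : 'I_n. *)
Definition insert_bit n (i : 'I_n) (b : bool) (a : hypercube n.-1) :
    hypercube n :=
  [ffun j => if unlift i j is Some k then a k else b].

Lemma hamming_insert_bit n (i : 'I_n) b (a a' : hypercube n.-1) :
  hamming (insert_bit i b a) (insert_bit i b a') = hamming a a'.
Proof.
rewrite /hamming -(card_imset _ (@lift_inj _ i)); apply: eq_card => j.
rewrite inE !ffunE; case: unliftP => [k ->|->].
  by rewrite mem_imset ?inE //; exact: lift_inj.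
by rewrite eqxx; apply/esym/imsetP => -[k _ /eqP]; rewrite (negPf (neq_lift _ _)).
Qed.

Lemma face_subproof n X (i : 'I_n) b (s : cube n X) :
  `[< lipschitz_cube [ffun a => s (insert_bit i b a)] >].
Proof.
apply/asboolP => a a'; rewrite !ffunE -(hamming_insert_bit i b).
exact: cube_lipschitz.
Qed.

(* With b = false and b = true these are A_i and B_i. *)
Definition face n X (i : 'I_n) (b : bool) (s : cube n X) : cube n.-1 X :=
  Cube (face_subproof i b s).

Definition degenerate n X (s : cube n X) : Prop :=
  exists i : 'I_n, face i false s = face i true s.

Definition chain n X := {freeg (cube n X)}.

Definition degenerate_chain n X : {pred chain n X} :=
  gen_subgroup [set (<< s >> : chain n X) | s in @degenerate n X].
HB.instance Definition _ n X :=
  GRing.ZmodClosed.copy (@degenerate_chain n X) (gen_subgroup _).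

Definition nchain n X : zmodType := {quot (@degenerate_chain n X)}.

(* Positions are counted from 0 here, so (-1)^i becomes (-1)^(i+1). In degree
   n = 0 the sum is empty: this is the zero map, with kernel everything, and it
   stands for the map to the zero group in degree -1. *)
Definition cube_boundary n X (s : cube n X) : chain n.-1 X :=
  \sum_(i < n) (<< face i false s >> - << face i true s >>) *~ (-1) ^+ i.+1.

Definition chain_boundary n X : {additive chain n X -> chain n.-1 X} :=
  freelift (@cube_boundary n X).

Lemma degenerate_face n X (i k : 'I_n) b (s : cube n X) :
  face k false s = face k true s -> i != k -> degenerate (face i b s).
Proof.
case: n i k s => [|n] i k s; first by case: i.
move=> sk; case/unlift_some => l kE _.
exists l; apply: val_inj; apply/ffunP => a; rewrite !ffunE.
have indep (c c' : hypercube n.+1) : (forall j, j != k -> c j = c' j) -> s c = s c'.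
  move=> cc'.
  have /(congr1 (fun t : cube n.+1.-1 X => t [ffun j => c (fintype.lift k j)])) := sk.
  have insE (d : hypercube n.+1) : (forall j, j != k -> c j = d j) ->
      insert_bit k (d k) [ffun j => c (fintype.lift k j)] = d.
    move=> cd; apply/ffunP => j; rewrite ffunE; case: unliftP => [m ->|-> //].
    by rewrite ffunE cd // eq_sym neq_lift.
  rewrite !ffunE => sE; rewrite -{1}(insE c) // -(insE c') //.
  by case: (c k); case: (c' k); rewrite ?sE.
apply: indep => j jk; rewrite !ffunE; case: unliftP => [m jE|//].
rewrite !ffunE; case: unliftP => [//|mE].
by move: jk; rewrite jE mE kE eqxx.
Qed.

Lemma chain_boundary_degenerate n X (x : chain n X) :
  x \in @degenerate_chain n X -> chain_boundary n X x \in @degenerate_chain n.-1 X.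
Proof.
move=> /asboolP xD; suff: [set y | chain_boundary n X y \in @degenerate_chain n.-1 X] x.
  by [].
apply: xD; split=> /=; first split => [|y z /= yD zD].
- by rewrite /= raddf0 rpred0.
- by rewrite raddfB rpredB.
- move=> _ [s [k sk] <-] /=; rewrite freeliftU; apply: rpred_sum => i _.
  have [->|ik] := eqVneq i k; first by rewrite sk subrr mul0rz rpred0.
  apply: rpredMz; apply: rpredB; apply/asboolP;
    by apply: sub_gen_smallest; eexists; last reflexivity;
       exact: degenerate_face sk ik.
Qed.

Definition boundary n X : {additive nchain n X -> nchain n.-1 X} :=
  quot_map (@chain_boundary_degenerate n X).

Definition cycle n X := kernel (boundary n X).

(* n.+1.-1 is n, so boundary n.+1 X lands in nchain n X. *)
Definition DH n X : zmodType :=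
  homology (boundary n.+1 X : {additive nchain n.+1 X -> nchain n X})
    (boundary n X).

Definition homology_class n X : {additive cycle n X -> DH n X} :=
  \pi_(DH n X).

Section ShortMap.
Variables (X Y : metricType R) (f : X -> Y).
Hypothesis fS : forall x y, mdist (f x) (f y) <= mdist x y.

Lemma push_cube_subproof n (s : cube n X) :
  `[< lipschitz_cube ([ffun a => f (s a)] : {ffun hypercube n -> Y}) >].
Proof.
apply/asboolP => a b; rewrite !ffunE.
exact: le_trans (fS _ _) (cube_lipschitz s a b).
Qed.

Definition push_cube n (s : cube n X) : cube n Y := Cube (push_cube_subproof s).

Definition push_chain n : {additive chain n X -> chain n Y} :=
  freelift (fun s => << push_cube s >>).

Lemma face_push n (i : 'I_n) b (s : cube n X) :
  face i b (push_cube s) = push_cube (face i b s).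
Proof. by apply: val_inj; apply/ffunP => a; rewrite !ffunE. Qed.

Lemma push_chain_degenerate n (x : chain n X) :
  x \in @degenerate_chain n X -> push_chain n x \in @degenerate_chain n Y.
Proof.
move=> /asboolP xD; suff: [set y | push_chain n y \in @degenerate_chain n Y] x by [].
apply: xD; split=> /=; first split => [|y z /= yD zD].
- by rewrite /= raddf0 rpred0.
- by rewrite raddfB rpredB.
- move=> _ [s [k sk] <-] /=; rewrite freeliftU; apply/asboolP.
  apply: sub_gen_smallest; exists (push_cube s) => //.
  by exists k; rewrite !face_push sk.
Qed.

Definition push_nchain n : {additive nchain n X -> nchain n Y} :=
  quot_map (@push_chain_degenerate n).

Lemma chain_boundary_push n (x : chain n X) :
  chain_boundary n Y (push_chain n x) = push_chain n.-1 (chain_boundary n X x).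
Proof.
move: x; apply: (@freelift_unique _ _
  (chain_boundary n Y \o push_chain n) (push_chain n.-1 \o chain_boundary n X)).
move=> s /=; rewrite !freeliftU raddf_sum; apply: eq_bigr => i _.
by rewrite raddfMz raddfB /= !freeliftU !face_push.
Qed.

Lemma boundary_push n (x : nchain n X) :
  boundary n Y (push_nchain n x) = push_nchain n.-1 (boundary n X x).
Proof.
rewrite -[x]reprK /= !quot_mapE; congr (\pi_(nchain n.-1 Y) _).
exact: chain_boundary_push.
Qed.

Definition DHmap n : {additive DH n X -> DH n Y} :=
  homology_map (@boundary_push n.+1) (@boundary_push n).
End ShortMap.

Section Inclusions.
Variables (X : metricType R).
Implicit Types (A B U V : set X).

Lemma subfun_short U V (UV : U `<=` V) (x y : set_type U) :
  mdist (subfun UV x) (subfun UV y) <= mdist x y.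
Proof. by rewrite !mdist_subE. Qed.

Definition incl_nchain n U V (UV : U `<=` V) :
    {additive nchain n (set_type U) -> nchain n (set_type V)} :=
  push_nchain (subfun_short UV) n.

Definition DHincl n U V (UV : U `<=` V) :
    {additive DH n (set_type U) -> DH n (set_type V)} :=
  DHmap (subfun_short UV) n.

Variables (A B : set X).

Definition MVdiag n (x : DH n (set_type (A `&` B))) :
    (DH n (set_type A) * DH n (set_type B))%type :=
  (DHincl n (@subIsetl _ A B) x, DHincl n (@subIsetr _ A B) x).

Definition MVdiff n (p : (DH n (set_type A) * DH n (set_type B))%type) :
    DH n (set_type (A `|` B)) :=
  DHincl n (@subsetUl _ A B) p.1 - DHincl n (@subsetUr _ A B) p.2.

(* The snake-lemma description: if the cycle z on A `|` B is the difference of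
   a chain a on A and a chain b on B whose boundaries both come from the cycle c
   on A `&` B, then delta sends the class of z to the class of c. *)
Definition is_connecting n
    (delta : DH n.+1 (set_type (A `|` B)) -> DH n (set_type (A `&` B))) :=
  forall (z : cycle n.+1 (set_type (A `|` B))) (c : cycle n (set_type (A `&` B)))
    (a : nchain n.+1 (set_type A)) (b : nchain n.+1 (set_type B)),
  val z = incl_nchain n.+1 (@subsetUl _ A B) a
          - incl_nchain n.+1 (@subsetUr _ A B) b ->
  boundary n.+1 (set_type A) a = incl_nchain n (@subIsetl _ A B) (val c) ->
  boundary n.+1 (set_type B) b = incl_nchain n (@subIsetr _ A B) (val c) ->
  delta (homology_class n.+1 (set_type (A `|` B)) z)
  = homology_class n (set_type (A `&` B)) c.

End Inclusions.

Definition discrete_cover X (I : Type) (U : I -> set X) : Prop :=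
  \bigcup_i U i = setT /\
  forall n (s : cube n X), ~ degenerate s -> exists i, forall a, U i (s a).

End Cubes.

(* Main.v *)
(* Discarding the cubes that leave a subspace U retracts the normalized chains
   onto those of U; with the cover hypothesis this gives, in each degree, a short
   exact sequence
     0 -> C(A & B) -> C(A) (+) C(B) -> C(A | B) -> 0
   of normalized chain groups. The theorem is its snake lemma: the connecting
   map is the single-valued relation which is_connecting describes. *)
From HB Require Import structures.
Require Import Defs.
From mathcomp Require Import all_boot all_order all_algebra.
From mathcomp Require Import zify.
From mathcomp Require Import generic_quotient ring_quotient.
From mathcomp.multinomials Require Import freeg.
From mathcomp Require Import all_classical reals metric_structure.
Local Open Scope classical_set_scope.
Local Open Scope quotient_scope.
Local Open Scope ring_scope.
Import Order.TTheory GRing.Theory Num.Theory.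

Set Implicit Arguments.
Unset Strict Implicit.
Unset Printing Implicit Defensive.

(** * Quotients, bit insertion and signed sums *)

Lemma quot_pi_eq0 (V : zmodType) (I : zmodClosed V) (x : V) :
  (\pi_({quot I}) x = 0) <-> x \in I.
Proof.
have := Quotient.idealrBE I x 0; rewrite subr0 raddf0 => ->.
by split=> [->|/eqP].
Qed.

(** [l'] and [i'] are the indices of [l] and [i] once the other position is removed. The two [lift]
    equations treat both orders of [i] and [l] at once. *)
Lemma insert_bitC n (i l : 'I_n.+2) (i' l' : 'I_n.+1) b c (a : hypercube n) :
  fintype.lift i l' = l -> fintype.lift l i' = i ->
  insert_bit i b (insert_bit l' c a) = insert_bit l c (insert_bit i' b a).
Proof.
move=> il li; apply/ffunP => j; rewrite !ffunE.
case: (unliftP i j) => [k jk|ji]; case: (unliftP l j) => [k' jk'|jl].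
- rewrite !ffunE; case: (unliftP l' k) => [m km|kl]; last first.
    by move: jk'; rewrite jk kl il => /eqP; rewrite (negPf (neq_lift _ _)).
  case: (unliftP i' k') => [m' km'|kl]; last first.
    by move: jk; rewrite jk' kl li => /eqP; rewrite (negPf (neq_lift _ _)).
  congr (a _); apply: val_inj.
  move: (congr1 val il) (congr1 val li) (congr1 val jk) (congr1 val jk').
  rewrite km km' /= /bump; lia.
- have -> : k = l'; last by rewrite ffunE unlift_none.
  by apply: (@lift_inj _ i); rewrite -jk il.
- have -> : k' = i'; last by rewrite ffunE unlift_none.
  by apply: (@lift_inj _ l); rewrite -jk' li.
- by move: il; rewrite -jl ji => /eqP; rewrite eq_sym (negPf (neq_lift _ _)).
Qed.

(** The entries below and above the diagonal cancel in pairs. Knowing only that the sum equals its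
    opposite would not suffice, since [V] may have 2-torsion. *)
Lemma sum_offdiag_antisym (V : zmodType) n (H : 'I_n -> 'I_n -> V) :
  (forall i, H i i = 0) -> (forall i j : 'I_n, (j < i)%N -> H i j = - H j i) ->
  \sum_i \sum_j H i j = 0.
Proof.
move=> H0 HN.
have -> : \sum_i \sum_j H i j
    = \sum_(i < n) \sum_(j < n | (j < i)%N) H i j
      + \sum_(i < n) \sum_(j < n | (i < j)%N) H i j.
  rewrite -big_split; apply: eq_bigr => i _ /=.
  rewrite (bigID (fun j : 'I_n => (j < i)%N)) /=; congr (_ + _).
  rewrite (bigD1 i) /= ?ltnn // H0 add0r; apply: eq_bigl => j.
  by rewrite -leqNgt ltn_neqAle eq_sym andbC.
rewrite [X in _ + X](exchange_big_dep xpredT) //= -big_split big1 // => i _ /=.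
by rewrite -big_split big1 // => j ji /=; rewrite HN // addNr.
Qed.

(** * The cubical chain complex *)

Section Complex.
Variables (R : realType) (r : R).
Implicit Types X Y : metricType R.

Lemma faceC n X (s : cube r n.+2 X) (i l : 'I_n.+2) (i' l' : 'I_n.+1) b c :
  fintype.lift i l' = l -> fintype.lift l i' = i ->
  face l' c (face i b s) = face i' b (face l c s).
Proof.
move=> il li; apply: val_inj; apply/ffunP => a.
by rewrite /= !ffunE (insert_bitC _ _ _ il li).
Qed.

Lemma chain_boundary0 X (x : chain r 0 X) : chain_boundary r 0 X x = 0.
Proof.
move: x; apply: (freelift_unique (g := \0 : {additive _ -> _})) => s.
by rewrite /= freeliftU /cube_boundary big_ord0.
Qed.

Lemma chain_boundary_boundary n X (x : chain r n.+1 X) :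
  chain_boundary r n X (chain_boundary r n.+1 X x) = 0.
Proof.
case: n x => [|n] x; first exact: chain_boundary0.
move: x; apply: (@freelift_unique _ _
  (chain_boundary r n.+1 X \o chain_boundary r n.+2 X) \0) => s /=.
pose G i j (c e : bool) : chain r n X := << face j c (face i e s) >>.
pose GG (i : 'I_n.+2) (j : 'I_n.+1) : chain r n X :=
  ((G i j false false - G i j true false) - (G i j false true - G i j true true))
    *~ ((-1) ^+ j.+1 * (-1) ^+ i.+1).
(* Indexing by pairs of directions of s makes the sum antisymmetric, by faceC. *)
pose H i l := if unlift i l is Some j then GG i j else 0.
transitivity (\sum_i \sum_l H i l); last first.
  apply: sum_offdiag_antisym => [i|i l li]; first by rewrite /H unlift_none.
  have il : i != l by rewrite -val_eqE neq_ltn li orbT.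
  rewrite /H; case: (unliftP i l) => [l' il'|/eqP]; last by rewrite eq_sym (negPf il).
  case: (unliftP l i) => [i' li'|/eqP]; last by rewrite (negPf il).
  (* As [l < i], removing [i] does not shift [l], while removing [l] lowers [i] by one; this makes
     the signs opposite. *)
  have sgn : ((-1) ^+ l'.+1 * (-1) ^+ i.+1 : int) = - ((-1) ^+ i'.+1 * (-1) ^+ l.+1).
    have -> : (l' : nat) = l by move: (congr1 val il') li; rewrite /= /bump; lia.
    have -> : (i : nat) = i'.+1 by move: (congr1 val li') li; rewrite /= /bump; lia.
    by rewrite mulrC [_ ^+ i'.+2]exprS mulN1r mulNr.
  rewrite /GG sgn mulrNz; congr (- (_ *~ _)).
  rewrite /G !(@faceC _ _ s i l i' l') //.
  by rewrite !opprB addrACA [RHS]addrACA; congr (_ + _); exact: addrC.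
(* The diagonal term is 0, and the remaining directions are the [lift i j], one for each direction
   [j] of a face. *)
rewrite freeliftU raddf_sum; apply: eq_bigr => i _.
rewrite (bigD1_ord i) //= {1}/H unlift_none add0r raddfMz raddfB /= !freeliftU.
rewrite /cube_boundary -sumrB /= mulrz_suml; apply: eq_bigr => j _.
by rewrite /H liftK -mulrzBl -mulrzA.
Qed.

Lemma boundary_boundary n X (x : nchain r n.+1 X) :
  boundary r n X (boundary r n.+1 X x) = 0.
Proof.
rewrite -[x]reprK /= !quot_mapE /=.
by rewrite (chain_boundary_boundary (n := n)) raddf0.
Qed.

Lemma boundary0 X (x : nchain r 0 X) : boundary r 0 X x = 0.
Proof. by rewrite -[x]reprK /= quot_mapE /= chain_boundary0 raddf0. Qed.

(** * Retraction along an injective short map *)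

Lemma push_cube_inj X Y (f : X -> Y)
    (fS : forall x y, mdist (f x) (f y) <= mdist x y) n :
  injective f -> injective (@push_cube _ r _ _ f fS n).
Proof.
move=> fI s t /(congr1 val)/ffunP st; apply: val_inj; apply/ffunP => a.
by have := st a; rewrite !ffunE => /fI.
Qed.

Lemma degenerate_push X Y (f : X -> Y)
    (fS : forall x y, mdist (f x) (f y) <= mdist x y) n (s : cube r n X) :
  injective f -> degenerate (push_cube fS s) -> degenerate s.
Proof.
move=> fI [k sk]; exists k; apply: (push_cube_inj fI (fS := fS)).
by rewrite -!face_push.
Qed.

Lemma push_nchainE X Y (f : X -> Y)
    (fS : forall x y, mdist (f x) (f y) <= mdist x y) n (x : chain r n X) :
  push_nchain r fS n (\pi_(nchain r n X) x) = \pi_(nchain r n Y) (push_chain r fS n x).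
Proof. exact: quot_mapE. Qed.

Section Pullback.
Variables (X Y : metricType R) (f : X -> Y).
Hypothesis fS : forall x y, mdist (f x) (f y) <= mdist x y.
Hypothesis fI : injective f.
Local Notation push := (@push_cube R r X Y f fS).

(** Injectivity of [f] makes the chosen preimage unique. A cube outside the image may have faces
    inside it, so this retraction need not commute with boundaries; it is used one degree at a
    time. *)
Definition pull_cube n (s : cube r n Y) : chain r n X :=
  if pselect (exists t, push t = s) is left e then << sval (cid e) >> else 0.

Lemma pull_push_cube n (t : cube r n X) : pull_cube (push t) = << t >>.
Proof.
rewrite /pull_cube; case: pselect => [e|[]]; last by exists t.
by case: (cid e) => u /= /(push_cube_inj fI) ->.
Qed.

Lemma pull_cube0 n (s : cube r n Y) :
  ~ (exists t, push t = s) -> pull_cube s = 0.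
Proof. by rewrite /pull_cube; case: pselect. Qed.

Definition pull_chain n : {additive chain r n Y -> chain r n X} :=
  freelift (@pull_cube n).

(** A degenerate cube either goes to 0 or has a preimage, which is degenerate because injective maps
    reflect degeneracy. *)
Lemma pull_chain_degenerate n (x : chain r n Y) :
  x \in @degenerate_chain R r n Y -> pull_chain n x \in @degenerate_chain R r n X.
Proof.
move=> /asboolP xD.
suff: [set y | pull_chain n y \in @degenerate_chain R r n X] x by [].
apply: xD; split=> /=; first split => [|y z /= yD zD].
- by rewrite /= raddf0 rpred0.
- by rewrite raddfB rpredB.
- move=> _ [s sD <-] /=; rewrite freeliftU.
  have [[t ts]|/pull_cube0 ->] := pselect (exists t, push t = s); last exact: rpred0.
  rewrite -ts pull_push_cube; apply/asboolP; apply: sub_gen_smallest.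
  by exists t => //; apply: (degenerate_push fI (fS := fS)); rewrite ts.
Qed.

Definition pull_nchain n : {additive nchain r n Y -> nchain r n X} :=
  quot_map (@pull_chain_degenerate n).

Lemma pull_nchainE n (x : chain r n Y) :
  pull_nchain n (\pi_(nchain r n Y) x) = \pi_(nchain r n X) (pull_chain n x).
Proof. exact: quot_mapE. Qed.

(** Through this left inverse, pushing forward stays injective after degenerate chains are divided
    out. *)
Lemma push_nchainK n : cancel (@push_nchain R r X Y f fS n) (pull_nchain n).
Proof.
move=> x; rewrite -[x]reprK push_nchainE pull_nchainE; congr (\pi_(_) _).
move: (repr x); apply: (freelift_unique (f := pull_chain n \o push_chain r fS n)
  (g := idfun : {additive _ -> _})) => s.
by rewrite /= !freeliftU pull_push_cube.
Qed.
End Pullback.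

(** * Normalized chains of subspaces *)

Section Subspaces.
Variable X : metricType R.
Implicit Types A B U V : set X.

Lemma subfun_inj U V (UV : U `<=` V) : injective (subfun UV).
Proof. by move=> x y /(congr1 val) xy; apply: val_inj. Qed.

Local Notation incl n UV := (@incl_nchain R r X n _ _ UV).
Local Notation pull n UV := (pull_nchain (subfun_short UV) (@subfun_inj _ _ UV) n).

Lemma cube_factor n U V (UV : U `<=` V) (s : cube r n (set_type V)) :
  (forall a, U (val (s a))) -> exists t, push_cube (subfun_short UV) t = s.
Proof.
move=> sU.
pose t : {ffun hypercube n -> set_type U} := [ffun a => SigSub (mem_set (sU a))].
have tP : `[< lipschitz_cube r t >].
  apply/asboolP => a b; rewrite !ffunE mdist_subE /= -mdist_subE.
  exact: cube_lipschitz.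
exists (Cube tP); apply: val_inj; apply/ffunP => a; rewrite !ffunE.
exact: val_inj.
Qed.

Lemma incl_nchainE n U V (UV : U `<=` V) (x : chain r n (set_type U)) :
  incl n UV (\pi_(nchain r n (set_type U)) x)
  = \pi_(nchain r n (set_type V)) (push_chain r (subfun_short UV) n x).
Proof. exact: quot_mapE. Qed.

Lemma incl_nchainK n U V (UV : U `<=` V) : cancel (incl n UV) (pull n UV).
Proof. exact: push_nchainK. Qed.

Lemma incl_nchain_inj n U V (UV : U `<=` V) : injective (incl n UV).
Proof. exact: can_inj (incl_nchainK UV). Qed.

Lemma incl_nchain_comp n U V V' W (UV : U `<=` V) (UV' : U `<=` V')
    (VW : V `<=` W) (VW' : V' `<=` W) x :
  incl n VW (incl n UV x) = incl n VW' (incl n UV' x).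
Proof.
rewrite -[x]reprK (incl_nchainE UV) (incl_nchainE UV').
rewrite (incl_nchainE VW) (incl_nchainE VW'); congr (\pi_(_) _); move: (repr x).
apply: (freelift_unique
  (f := push_chain r (subfun_short VW) n \o push_chain r (subfun_short UV) n)
  (g := push_chain r (subfun_short VW') n \o push_chain r (subfun_short UV') n)) => s.
rewrite /= !freeliftU; congr << _ >>; apply: val_inj; apply/ffunP => a.
by rewrite !ffunE; apply: val_inj.
Qed.

(** The hypotheses make [U] the intersection of [V] and [V']. A cube of [V'] that comes from [V]
    inside [W] has its values in that intersection, hence comes from [U]; any other cube is killed
    on both sides. *)
Lemma pull_incl n U V V' W (UV : U `<=` V) (UV' : U `<=` V')
    (VW : V `<=` W) (VW' : V' `<=` W) x :
  V `&` V' `<=` U ->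
  pull n VW (incl n VW' x) = incl n UV (pull n UV' x).
Proof.
move=> VU; rewrite -[x]reprK (incl_nchainE VW').
rewrite (pull_nchainE (subfun_short UV')) (pull_nchainE (subfun_short VW)).
rewrite (incl_nchainE UV).
congr (\pi_(_) _); move: (repr x).
apply: (freelift_unique
  (f := pull_chain (subfun_short VW) n \o push_chain r (subfun_short VW') n)
  (g := push_chain r (subfun_short UV) n \o pull_chain (subfun_short UV') n)) => s.
rewrite /= !freeliftU.
have [[t ts]|sU] := pselect (exists t, push_cube (subfun_short UV') t = s).
  rewrite -ts (pull_push_cube _ (@subfun_inj _ _ UV')) /= freeliftU.
  rewrite -(pull_push_cube (subfun_short VW) (@subfun_inj _ _ VW)); congr pull_cube.
  apply: val_inj; apply/ffunP => a.
  by rewrite !ffunE; apply: val_inj.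
rewrite (pull_cube0 sU) raddf0 pull_cube0 // => -[t ts]; apply: sU.
apply: cube_factor => a; apply: VU; split; last exact/set_mem/(valP (s a)).
have /(congr1 (fun c : cube r n (set_type W) => val (c a))) := ts.
by rewrite !ffunE /= => <-; exact/set_mem/(valP (t a)).
Qed.

Variables A B : set X.
Local Notation iA n := (incl n (@subIsetl _ A B)).
Local Notation iB n := (incl n (@subIsetr _ A B)).
Local Notation jA n := (incl n (@subsetUl _ A B)).
Local Notation jB n := (incl n (@subsetUr _ A B)).

Lemma jA_iA n x : jA n (iA n x) = jB n (iB n x).
Proof. exact: incl_nchain_comp. Qed.

(** Exactness in the middle of the chain sequence. By [pull_incl], the restriction of [b] to the
    intersection, seen in [A], is the restriction to [A] of [jB n b = jA n a], which is [a]. *)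
Lemma glue_nchain n a b : jA n a = jB n b -> exists c, iA n c = a /\ iB n c = b.
Proof.
move=> ab; pose c := pull n (@subIsetr _ A B) b.
have ac : a = iA n c.
  by rewrite -(incl_nchainK (@subsetUl _ A B) a) ab; exact: pull_incl.
exists c; split=> //; apply: (@incl_nchain_inj n _ _ (@subsetUr _ A B)).
by rewrite -ab ac jA_iA.
Qed.

(** * Splitting chains along the cover *)

Hypothesis AB_cover : discrete_cover r (fun b : bool => if b then A else B).

(** The cover hypothesis enters here: a generator is degenerate, hence zero in the quotient, or it
    lies in [A] or in [B]. *)
Lemma split_nchain n z : exists a b, z = jA n a - jB n b.
Proof.
rewrite -[z]reprK; elim/freeg_ind_gen: (repr z) => [|s|x y [a [b xab]] [c [d ycd]]].
- by exists 0, 0; rewrite !raddf0 addr0.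
(* The cover speaks of cubes of [X], so [s] is pushed into [X]; degeneracy there reflects back to
   [s]. *)
- have valS (x y : set_type (A `|` B)) : mdist (val x) (val y) <= mdist x y.
    by rewrite mdist_subE.
  have [sD|/AB_cover.2[i si]] := pselect (degenerate (push_cube valS s)).
    exists 0, 0; rewrite !raddf0 addr0; apply/quot_pi_eq0/asboolP.
    apply: sub_gen_smallest; exists s => //.
    by apply: (degenerate_push _ sD); exact: val_inj.
  case: i si => /= si.
  + have [|t <-] := @cube_factor n _ _ (@subsetUl _ A B) s.
      by move=> a; have := si a; rewrite ffunE.
    exists (\pi_(_) << t >>), 0.
    by rewrite raddf0 subr0 incl_nchainE /= freeliftU.
  + have [|t <-] := @cube_factor n _ _ (@subsetUr _ A B) s.
      by move=> a; have := si a; rewrite ffunE.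
    (* The sign undoes the subtraction of the [B] part. *)
    exists 0, (\pi_(_) (- << t >>)).
    by rewrite raddf0 sub0r incl_nchainE raddfN /= freeliftU raddfN opprK.
- exists (a - c), (b - d); transitivity (jA n a - jB n b - (jA n c - jB n d)).
    by rewrite -xab -ycd raddfB.
  by rewrite !raddfB addrACA.
Qed.

(** * Cycles and homology classes by representatives *)

Local Notation hcls n U := (homology_class r n (set_type U)).

Lemma boundary_incl n U V (UV : U `<=` V) x :
  boundary r n.+1 (set_type V) (incl n.+1 UV x)
  = incl n UV (boundary r n.+1 (set_type U) x).
Proof. exact: boundary_push. Qed.

Lemma boundary_incl_pred n U V (UV : U `<=` V) x :
  boundary r n (set_type V) (incl n UV x)
  = incl n.-1 UV (boundary r n (set_type U) x).
Proof. exact: boundary_push. Qed.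

Lemma cycleW n (Y : metricType R) (x : nchain r n Y) :
  boundary r n Y x = 0 -> exists z : Defs.cycle r n Y, val z = x.
Proof. by move=> /eqP xZ; exists (Sub x xZ); rewrite SubK. Qed.

Lemma homology_class_surj n (Y : metricType R) (y : DH r n Y) :
  exists z, homology_class r n Y z = y.
Proof. by exists (repr y); exact: reprK. Qed.

Lemma homology_class_eq0 n (Y : metricType R) (z : Defs.cycle r n Y) :
  homology_class r n Y z = 0 <-> exists w, boundary r n.+1 Y w = val z.
Proof.
apply: (iff_trans (quot_pi_eq0 _ _)).
by split=> [/asboolP|zB]; last apply/asboolP.
Qed.

Lemma homology_class_eq n (Y : metricType R) (z z' : Defs.cycle r n Y) :
  homology_class r n Y z = homology_class r n Y z' <->
  exists w, boundary r n.+1 Y w = val z - val z'.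
Proof.
have -> : val z - val z' = val (z - z') by rewrite raddfB.
apply: iff_trans (homology_class_eq0 (z - z')).
by rewrite raddfB; split=> [->|/eqP]; rewrite ?subrr // subr_eq0 => /eqP.
Qed.

Lemma DHincl_class n U V (UV : U `<=` V) z z' :
  val z' = incl n UV (val z) -> DHincl r n UV (hcls n U z) = hcls n V z'.
Proof.
move=> zz'; apply: etrans (quot_mapE _ _) _.
by congr (\pi_(_) _); apply: val_inj; rewrite zz'.
Qed.

Lemma cycle_incl n U V (UV : U `<=` V) (z : Defs.cycle r n (set_type U)) :
  exists z' : Defs.cycle r n (set_type V), val z' = incl n UV (val z).
Proof. by apply: cycleW; rewrite boundary_incl_pred kernelP raddf0. Qed.

Lemma boundary_diff n a b :
  boundary r n.+1 _ (jA n.+1 a - jB n.+1 b)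
  = jA n (boundary r n.+1 _ a) - jB n (boundary r n.+1 _ b).
Proof. by rewrite raddfB !boundary_incl. Qed.

(* a and b are corrected by boundaries so that they agree on the nose. *)
Lemma glue_homologous n a b w : boundary r n.+1 _ w = jA n a - jB n b ->
  exists u v c, iA n c = a - boundary r n.+1 _ u /\ iB n c = b - boundary r n.+1 _ v.
Proof.
have [u [v ->]] := split_nchain w; rewrite boundary_diff => uv.
exists u, v; apply: glue_nchain; apply/eqP; rewrite -subr_eq0 !raddfB.
by rewrite opprK addrACA -uv addrACA subrr addNr addr0.
Qed.

(** * The connecting homomorphism *)

(** The snake construction as a relation, so that no choices need tracking: being total, closed
    under differences and trivial over 0, it is the graph of a homomorphism. *)
Definition connects n (y : DH r n.+1 (set_type (A `|` B)))
    (x : DH r n (set_type (A `&` B))) : Prop :=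
  exists (z : Defs.cycle r n.+1 (set_type (A `|` B)))
    (c : Defs.cycle r n (set_type (A `&` B))) a b,
  [/\ y = hcls n.+1 (A `|` B) z /\ x = hcls n (A `&` B) c,
      val z = jA n.+1 a - jB n.+1 b,
      boundary r n.+1 _ a = iA n (val c)
    & boundary r n.+1 _ b = iB n (val c)].

(** Once a cycle is split as [jA a - jB b], the boundaries of [a] and [b] agree on the union, so
    they glue. *)
Lemma connects_total n y : exists x, @connects n y x.
Proof.
have [z <-] := homology_class_surj y; have [a [b zab]] := split_nchain (val z).
have /glue_nchain[c [ca cb]] :
    jA n (boundary r n.+1 _ a) = jB n (boundary r n.+1 _ b).
  by apply/eqP; rewrite -subr_eq0 -boundary_diff -zab kernelP.
(* The glued chain is a cycle because its boundary, seen in [A], is the boundary of a boundary. *)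
have [c' cE] : exists c' : Defs.cycle r n (set_type (A `&` B)), val c' = c.
  apply: cycleW; apply: (@incl_nchain_inj n.-1 _ _ (@subIsetl _ A B)).
  by rewrite raddf0 -boundary_incl_pred ca boundary_boundary.
by exists (hcls n (A `&` B) c'), z, c', a, b; rewrite cE.
Qed.

Lemma connectsB n y y' x x' :
  @connects n y x -> connects y' x' -> connects (y - y') (x - x').
Proof.
move=> [z [c [a [b [[-> ->] zab ac bc]]]]] [z' [c' [a' [b' [[-> ->] zab' ac' bc']]]]].
exists (z - z'), (c - c'), (a - a'), (b - b'); split.
- by rewrite !raddfB.
- by rewrite raddfB /= zab zab' !raddfB addrACA.
- by rewrite !raddfB /= ac ac'.
- by rewrite !raddfB /= bc bc'.
Qed.

(** If [z] bounds, [a] differs by a boundary from a chain [e] of the intersection; then [e] and [a]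
    have the same boundary in [A], so [c] is the boundary of [e]. *)
Lemma connects0 n x : @connects n 0 x -> x = 0.
Proof.
move=> [z [c [a [b [[/esym/homology_class_eq0[w wz] ->] zab ac bc]]]]].
have [|u [v [e [ea _]]]] := @glue_homologous n.+1 a b w; first by rewrite wz.
apply/homology_class_eq0; exists e.
apply: (@incl_nchain_inj n _ _ (@subIsetl _ A B)).
by rewrite -boundary_incl ea raddfB boundary_boundary subr0.
Qed.

(** Identifying the whole graph lets the exactness proofs turn values of [delta] into chain data and
    back. *)
Lemma connecting_exists n :
  exists delta : {additive DH r n.+1 (set_type (A `|` B))
                  -> DH r n (set_type (A `&` B))},
  forall y x, connects y x <-> delta y = x.
Proof.
pose f y := sval (cid (@connects_total n y)).
have fP y : connects y (f y) by rewrite /f; case: cid.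
have f_eq y x : connects y x -> f y = x.
  by move=> yx; apply/eqP; rewrite -subr_eq0; apply/eqP/connects0;
    rewrite -(subrr y); exact: connectsB.
have fB : zmod_morphism f by move=> y y'; apply: f_eq; exact: connectsB.
pose F : {additive DH r n.+1 (set_type (A `|` B)) -> DH r n (set_type (A `&` B))} :=
  HB.pack f (GRing.isZmodMorphism.Build _ _ f fB).
by exists F => y x; split=> [|<-]; [exact: f_eq | exact: fP].
Qed.

(** * Exactness of the long sequence *)

Lemma MVdiag_class n c a b : val a = iA n (val c) -> val b = iB n (val c) ->
  @MVdiag R r X A B n (hcls n (A `&` B) c) = (hcls n A a, hcls n B b).
Proof. by move=> ac bc; rewrite /MVdiag (DHincl_class ac) (DHincl_class bc). Qed.

Lemma MVdiff_class n a b z : val z = jA n (val a) - jB n (val b) ->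
  @MVdiff R r X A B n (hcls n A a, hcls n B b) = hcls n (A `|` B) z.
Proof.
move=> zab; rewrite /MVdiff /=.
have [a' aE] := cycle_incl (@subsetUl _ A B) a.
have [b' bE] := cycle_incl (@subsetUr _ A B) b.
rewrite (DHincl_class aE) (DHincl_class bE) -raddfB; congr (homology_class _ _ _ _).
by apply: val_inj; rewrite raddfB /= aE bE.
Qed.

Lemma MVdiff_classE n a b : exists2 z, val z = jA n (val a) - jB n (val b) &
  @MVdiff R r X A B n (hcls n A a, hcls n B b) = hcls n (A `|` B) z.
Proof.
have [a' aE] := cycle_incl (@subsetUl _ A B) a.
have [b' bE] := cycle_incl (@subsetUr _ A B) b.
have zab : val (a' - b') = jA n (val a) - jB n (val b) by rewrite raddfB /= aE bE.
by exists (a' - b') => //; exact: MVdiff_class.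
Qed.

Lemma exact_diag_diff n : exact_at (@MVdiag R r X A B n) (@MVdiff R r X A B n).
Proof.
move=> [x y]; have [a <-] := homology_class_surj x.
have [b <-] := homology_class_surj y.
have [z zab ->] := MVdiff_classE a b.
split=> [/homology_class_eq0[w wz]|[u]]; last first.
  have [c <-] := homology_class_surj u.
  have [a' ac] := cycle_incl (@subIsetl _ A B) c.
  have [b' bc] := cycle_incl (@subIsetr _ A B) c.
  rewrite (MVdiag_class ac bc) => -[/homology_class_eq[w wa] /homology_class_eq[v vb]].
  (* [a'] and [b'] have the same image in the union, so [jA a - jB b] is what remains of the
     corrections [w] and [v]. *)
  apply/homology_class_eq0; exists (jB n.+1 v - jA n.+1 w).
  rewrite raddfB !boundary_incl wa vb !raddfB /= ac bc jA_iA zab.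
  by rewrite opprK addrACA subrr add0r addrC.
(* Conversely, a bounding chain [w] lets [a] and [b] be corrected by boundaries to come from one
   chain [e], whose boundary vanishes because it does in [A]. *)
have [|u [v [e [ea eb]]]] := @glue_homologous n (val a) (val b) w; first by rewrite wz.
have [c cE] : exists c : Defs.cycle r n (set_type (A `&` B)), val c = e.
  apply: cycleW; apply: (@incl_nchain_inj n.-1 _ _ (@subIsetl _ A B)).
  by rewrite raddf0 -boundary_incl_pred ea raddfB kernelP boundary_boundary subr0.
exists (hcls n (A `&` B) c).
have [a' ac] := cycle_incl (@subIsetl _ A B) c.
have [b' bc] := cycle_incl (@subIsetr _ A B) c.
rewrite (MVdiag_class ac bc); congr pair; apply/homology_class_eq.
- by exists (- u); rewrite ac cE ea raddfN addrC addKr.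
- by exists (- v); rewrite bc cE eb raddfN addrC addKr.
Qed.

Section Exactness.
Variable n : nat.
Variable delta : DH r n.+1 (set_type (A `|` B)) -> DH r n (set_type (A `&` B)).
Hypothesis deltaP : forall y x, connects y x <-> delta y = x.

Lemma connects_is_connecting : is_connecting delta.
Proof. by move=> z c a b zab ac bc; apply/deltaP; exists z, c, a, b. Qed.

Lemma exact_diff_connecting : exact_at (@MVdiff R r X A B n.+1) delta.
Proof.
move=> y; split=> [/deltaP|[[x x']]].
  move=> [z [c [a [b [[-> /esym/homology_class_eq0[w wc]] zab ac bc]]]]].
  (* When [c] bounds [w], subtracting [w] turns [a] and [b] into cycles, and the two copies of [w]
     cancel in the union. *)
  have [a' aE] : exists a' : Defs.cycle r n.+1 (set_type A), val a' = a - iA n.+1 w.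
    by apply: cycleW; rewrite raddfB boundary_incl wc ac subrr.
  have [b' bE] : exists b' : Defs.cycle r n.+1 (set_type B), val b' = b - iB n.+1 w.
    by apply: cycleW; rewrite raddfB boundary_incl wc bc subrr.
  exists (hcls n.+1 A a', hcls n.+1 B b'); apply: MVdiff_class.
  by rewrite aE bE !raddfB opprK addrACA jA_iA addNr addr0.
have [a <-] := homology_class_surj x; have [b <-] := homology_class_surj x'.
have [z zab -> <-] := MVdiff_classE a b; apply/deltaP.
(* Here [a] and [b] are already cycles, so the connecting cycle is 0. *)
exists z, 0, (val a), (val b); rewrite !raddf0; split=> //.
all: exact: kernelP.
Qed.

Lemma exact_connecting_diag : exact_at delta (@MVdiag R r X A B n).
Proof.
move=> x; split=> [|[y /deltaP[z [c [u [v [[_ ->] _ uc vc]]]]]]]; last first.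
  have [a ac] := cycle_incl (@subIsetl _ A B) c.
  have [b bc] := cycle_incl (@subIsetr _ A B) c.
  rewrite (MVdiag_class ac bc); congr pair; apply/homology_class_eq0.
  - by exists u; rewrite uc ac.
  - by exists v; rewrite vc bc.
have [c <-] := homology_class_surj x.
have [a ac] := cycle_incl (@subIsetl _ A B) c.
have [b bc] := cycle_incl (@subIsetr _ A B) c.
rewrite (MVdiag_class ac bc).
move=> [/homology_class_eq0[u ua] /homology_class_eq0[v vb]].
(* The chains bounding [c] in [A] and in [B] fit together into a cycle on the union, which [delta]
   sends back to [c]. *)
have [z zuv] : exists z : Defs.cycle r n.+1 (set_type (A `|` B)),
    val z = jA n.+1 u - jB n.+1 v.
  by apply: cycleW; rewrite boundary_diff ua vb ac bc jA_iA subrr.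
exists (hcls n.+1 (A `|` B) z); apply/deltaP; exists z, c, u, v.
by rewrite ua vb.
Qed.
End Exactness.

(** The right end of the sequence: in degree 0 every chain is a cycle, so splitting a chain already
    splits its class. *)
Lemma MVdiff0_surj y : exists x, @MVdiff R r X A B 0 x = y.
Proof.
have [z <-] := homology_class_surj y; have [a [b zab]] := split_nchain (val z).
have [a' aE] := cycleW (boundary0 a); have [b' bE] := cycleW (boundary0 b).
exists (hcls 0 A a', hcls 0 B b'); apply: MVdiff_class.
by rewrite zab aE bE.
Qed.
End Subspaces.
End Complex.

Theorem theorem3p4 (R : realType) (X : metricType R) (r : R) (A B : set X)
    (r_gt0 : 0 < r)
    (AB_cover : discrete_cover r (fun b : bool => if b then A else B)) :
  exists delta : forall n : nat,
    {additive DH r n.+1 (set_type (A `|` B)) -> DH r n (set_type (A `&` B))},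
    (forall n : nat, is_connecting (delta n)) /\
    [/\ forall n : nat, exact_at (@MVdiag R r X A B n) (@MVdiff R r X A B n),
        forall n : nat, exact_at (@MVdiff R r X A B n.+1) (delta n),
        forall n : nat, exact_at (delta n) (@MVdiag R r X A B n)
      & forall y : DH r 0 (set_type (A `|` B)),
          exists x, @MVdiff R r X A B 0 x = y].
Proof.
have H := connecting_exists AB_cover.
exists (fun n => sval (cid (H n))); split=> [n|].
  exact/connects_is_connecting/(svalP (cid (H n))).
split=> [n|n|n|y].
- exact: exact_diag_diff.
- exact: exact_diff_connecting (svalP (cid (H n))).
- exact: exact_connecting_diag (svalP (cid (H n))).
- exact: MVdiff0_surj.
Qed.
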